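(* Let $S$ and $S'$ be two $m$-optimal sets of binary strings. Then there exists a computable bijection $h$ on binary strings with $h(S)=S'$ (i.e. $x\in S\Leftrightarrow h(x)\in S'$) such that both $h$ and $h^{-1}$ are length-bounded (so $|h(x)|=|x|+O(1)$).
   Context: A total function $h$ on binary strings is length-bounded if $|h(x)|\le|x|+c$ for some $c$ and all $x$. An enumerable set $S$ is $m$-optimal if for every enumerable set $W$ there is a length-bounded total computable $h$ with $x\in W\Leftrightarrow h(x)\in S$ for all $x$. *)

(* Defs.v *)
From mathcomp Require Import all_boot.
Set Implicit Arguments. Unset Strict Implicit. Unset Printing Implicit Defensive.

(* Bijective coding of binary strings by natural numbers:
   [::] |-> 0,  b :: s |-> 2 * code s + 1 + b.  (bijection seq bool <-> nat) *)
Fixpoint code (s : seq bool) : nat :=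
  match s with
  | [::] => 0
  | b :: s' => (code s').*2 + 1 + b
  end.

Inductive prf : Type :=
| PZero : prf
| PSucc : prf
| PProj : nat -> prf
| PComp : prf -> list prf -> prf
| PPrim : prf -> prf -> prf
| PMin  : prf -> prf.

Inductive evalp : prf -> seq nat -> nat -> Prop :=
| eZero v : evalp PZero v 0
| eSucc v : evalp PSucc v (head 0 v).+1
| eProj i v : evalp (PProj i) v (nth 0 v i)
| eComp f gs v ws y : evalps gs v ws -> evalp f ws y -> evalp (PComp f gs) v y
| ePrim0 f g v y : evalp f v y -> evalp (PPrim f g) (0 :: v) y
| ePrimS f g n v r y :
    evalp (PPrim f g) (n :: v) r -> evalp g (n :: r :: v) y ->
    evalp (PPrim f g) (n.+1 :: v) y
| eMin f v n :
    evalp f (n :: v) 0 ->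
    (forall k, k < n -> exists m, evalp f (k :: v) m.+1) ->
    evalp (PMin f) v n
with evalps : seq prf -> seq nat -> seq nat -> Prop :=
| esNil v : evalps [::] v [::]
| esCons g gs v y ys : evalp g v y -> evalps gs v ys -> evalps (g :: gs) v (y :: ys).

Definition computable (h : seq bool -> seq bool) : Prop :=
  exists p, forall x, evalp p [:: code x] (code (h x)).

Definition enumerable (W : seq bool -> Prop) : Prop :=
  exists p, forall x, W x <-> exists y, evalp p [:: code x] y.

Definition length_bounded (h : seq bool -> seq bool) : Prop :=
  exists c, forall x, size (h x) <= size x + c.

Definition m_optimal (S : seq bool -> Prop) : Prop :=
  enumerable S /\
  forall W, enumerable W ->
    exists h, computable h /\ length_bounded h /\ (forall x, W x <-> S (h x)).

(* Main.v *)
Require Import Defs.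
From mathcomp Require Import all_boot.
From mathcomp Require Import zify.
Set Implicit Arguments. Unset Strict Implicit. Unset Printing Implicit Defensive.

(* Strings are coded by numbers, and length-bounded means at most linear on codes.

   Let S be m-optimal, A enumerable. The set of pairs <c, z> with R c z reduces to S; by
   universality, R c can be designed knowing, for c an index of that reduction, the map
   f z = (image of <c, z>) that reduces R c itself to S. If f has a first collision
   f y = f z with y < z, then z is put into R c exactly when y has been left out, which contradicts
   f y = f z; hence f is injective. As long as there is no collision, z is made a copy of x, where
   x is the number of copies chosen before z, provided that f z > x. By injectivity the copy of x is
   at most 2x + 1. So A reduces to S by an injective, linearly bounded g with g x > x.

   Given such g from S to S' and g' from S' to S, the backward chains x, g'^-1 x, g^-1 (g'^-1 x)
   and so on decrease, hence are finite, and the Cantor-Bernstein bijection is computable. *)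

(** * Evaluation of programs *)

(** The premise of [eMin] nests evaluations under [exists]. The explicit fixpoint matches on
    [ek k lt], so that the inner evaluation is structurally smaller and has an induction
    hypothesis. *)
Lemma evalp_mut_ind (P : prf -> seq nat -> nat -> Prop)
    (Q : seq prf -> seq nat -> seq nat -> Prop) :
  (forall v, P PZero v 0) ->
  (forall v, P PSucc v (head 0 v).+1) ->
  (forall i v, P (PProj i) v (nth 0 v i)) ->
  (forall f gs v ws y, Q gs v ws -> P f ws y -> P (PComp f gs) v y) ->
  (forall f g v y, P f v y -> P (PPrim f g) (0 :: v) y) ->
  (forall f g n v r y, P (PPrim f g) (n :: v) r -> P g (n :: r :: v) y ->
     P (PPrim f g) (n.+1 :: v) y) ->
  (forall f v n, P f (n :: v) 0 ->
     (forall k, k < n -> exists m, P f (k :: v) m.+1) -> P (PMin f) v n) ->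
  (forall v, Q [::] v [::]) ->
  (forall g gs v y ys, P g v y -> Q gs v ys -> Q (g :: gs) v (y :: ys)) ->
  forall p v y, evalp p v y -> P p v y.
Proof.
move=> hZ hS hP hC h0 hR hM hN hK.
exact: (fix F p v y (e : evalp p v y) {struct e} : P p v y :=
  match e in evalp p v y return P p v y with
  | eZero v => hZ v
  | eSucc v => hS v
  | eProj i v => hP i v
  | @eComp f gs v ws y eg ef => hC f gs v ws y (G gs v ws eg) (F f ws y ef)
  | @ePrim0 f g v y ef => h0 f g v y (F f v y ef)
  | @ePrimS f g n v r y er eg => hR f g n v r y (F _ _ _ er) (F _ _ _ eg)
  | @eMin f v n ef ek => hM f v n (F _ _ _ ef)
      (fun k lt => match ek k lt with
         ex_intro m em => ex_intro _ m (F _ _ _ em) end)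
  end
with G gs v ws (e : evalps gs v ws) {struct e} : Q gs v ws :=
  match e in evalps gs v ws return Q gs v ws with
  | esNil v => hN v
  | @esCons g gs v y ys eg egs => hK g gs v y ys (F _ _ _ eg) (G _ _ _ egs)
  end
for F).
Qed.

Lemma evalp_fun p v y y' : evalp p v y -> evalp p v y' -> y = y'.
Proof.
move=> e; move: p v y e y'.
apply: (evalp_mut_ind
  (P := fun p v y => forall y', evalp p v y' -> y = y')
  (Q := fun gs v ws => forall ws', evalps gs v ws' -> ws = ws')).
- by move=> v y' e; inversion e.
- by move=> v y' e; inversion e.
- by move=> i v y' e; inversion e.
- move=> f gs v ws y IHg IHf y' e; inversion e as [| | |? ? ? ? ? eg ef| | |]; subst.
  by apply: IHf; rewrite (IHg _ eg).
- by move=> f g v y IH y' e; inversion e; subst; apply: IH.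
- move=> f g n v r y IHr IHg y' e; inversion e as [| | | | |? ? ? ? ? ? er eg|]; subst.
  by apply: IHg; rewrite (IHr _ er).
- move=> f v n IH0 IHk n' e; inversion e as [| | | | | |? ? ? e0 ek]; subst.
  (* If the two results differ, at the smaller one the program would yield both zero and a
     successor. *)
  case: (ltngtP n n') => // lt.
    by have [m /IH0] := ek _ lt.
  by have [m IH] := IHk _ lt; have := IH _ e0.
- by move=> v ws' e; inversion e.
- move=> g gs v y ys IHg IHgs ws' e; inversion e as [|? ? ? ? ? eg egs]; subst.
  by rewrite (IHg _ eg) (IHgs _ egs).
Qed.

(** * Total computable functions of vectors *)

(* Programs have no arity, but the recursor consumes the whole vector: to feed it a new first
   entry, [tc_rec] must copy the rest, which takes a vector of known size. *)
Definition tc n (f : seq nat -> nat) : Prop :=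
  exists p, forall v, size v = n -> evalp p v (f v).

Lemma eq_tc n f g : (forall v, size v = n -> f v = g v) -> tc n f -> tc n g.
Proof. by move=> fg [p pP]; exists p => v sv; rewrite -fg //; apply: pP. Qed.

Lemma tc_nth n i : tc n (fun v => nth 0 v i).
Proof. by exists (PProj i) => v _; apply: eProj. Qed.

Lemma tc_subst m n f h : tc m f -> (forall v, size v = n -> size (h v) = m) ->
  (forall i, i < m -> tc n (fun v => nth 0 (h v) i)) -> tc n (fun v => f (h v)).
Proof.
case=> p pP sh hh.
suff [gs gsP] : exists gs, forall v, size v = n -> evalps gs v (h v).
  by exists (PComp p gs) => v sv; apply: eComp (gsP _ sv) _; apply/pP/sh.
elim: m h sh hh {p pP} => [|m IH] h sh hh.
  exists [::] => v sv; rewrite (size0nil (sh _ sv)); exact: esNil.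
have [q qP] := hh 0 isT.
have [v sv|i im|gs gsP] := IH (fun v => behead (h v)).
- by rewrite size_behead sh.
- by apply: eq_tc (hh i.+1 im) => v _; rewrite nth_behead.
exists (q :: gs) => v sv; have := gsP _ sv; have := qP _ sv.
by case: (h v) (sh _ sv) => //= a l _; apply: esCons.
Qed.

Lemma tc_app1 F n a : tc 1 (fun v => F (nth 0 v 0)) -> tc n a ->
  tc n (fun v => F (a v)).
Proof.
move=> tF ta; apply: (tc_subst (h := fun v => [:: a v]) tF) => //.
by case.
Qed.

Lemma tc_app2 F n a b : tc 2 (fun v => F (nth 0 v 0) (nth 0 v 1)) ->
  tc n a -> tc n b -> tc n (fun v => F (a v) (b v)).
Proof.
move=> tF ta tb; apply: (tc_subst (h := fun v => [:: a v; b v]) tF) => //.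
by case=> [|[]].
Qed.

Lemma tc_const n c : tc n (fun=> c).
Proof.
elim: c => [|c [p pP]]; first by exists PZero => v _; apply: eZero.
exists (PComp PSucc [:: p]) => v sv.
by apply: (eComp (ws := [:: c])); [apply: esCons (pP v sv) (esNil _) | apply: eSucc].
Qed.

Lemma tc_succ n a : tc n a -> tc n (fun v => (a v).+1).
Proof.
apply: tc_app1; exists PSucc => v _; rewrite nth0; exact: eSucc.
Qed.

(* Inside a binder the environment is [k :: v]; the variables of the outer
   context are then read in [drop 1 w], and nested binders pile up [drop]s. *)
Definition is_drop (e : seq nat -> seq nat) := exists k, forall w, e w = drop k w.

Lemma is_drop_id : is_drop id.
Proof. by exists 0 => w; rewrite drop0. Qed.

Lemma is_drop_drop k e : is_drop e -> is_drop (fun w => drop k (e w)).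
Proof. by case=> j eP; exists (k + j) => w; rewrite eP drop_drop. Qed.

Lemma tc_nth_drop n e i : is_drop e -> tc n (fun w => nth 0 (e w) i).
Proof.
by case=> k eP; apply: eq_tc (tc_nth n (k + i)) => w _; rewrite eP nth_drop.
Qed.

Lemma tc_rec n N B st : tc n N -> tc n B ->
  tc n.+2 (fun w => st (nth 0 w 0) (nth 0 w 1) (drop 2 w)) ->
  tc n (fun v => nat_rect (fun=> nat) (B v) (fun k r => st k r v) (N v)).
Proof.
move=> tN [b bP] [s sP].
(* [PPrim] recurses on the first entry of the vector; [N v] is put there afterwards by
   substitution. *)
have tr : tc n.+1 (fun w => nat_rect (fun=> nat) (B (drop 1 w))
    (fun k r => st k r (drop 1 w)) (nth 0 w 0)).
  exists (PPrim b s); case=> // k v [sv] /=; rewrite drop0.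
  elim: k => [|k IH] /=; first exact/ePrim0/bP.
  apply: ePrimS IH _.
  set r := nat_rect _ _ _ _.
  by have := sP (k :: r :: v); rewrite /= drop0 sv; apply.
apply: eq_tc (tc_subst (n := n) (h := fun v => N v :: v) tr _ _).
- by move=> v _ /=; rewrite drop0.
- by move=> v <-.
- by case=> [|i] _ //=; apply: tc_nth.
Qed.

(** Weakening for use in the step of a recursion, where the accumulator stands between the counter
    and the context. *)
Lemma tc_lift n P : tc n.+1 (fun w => P (nth 0 w 0) (drop 1 w)) ->
  tc n.+2 (fun w => P (nth 0 w 0) (drop 2 w)).
Proof.
move=> tP; have := tc_subst (n := n.+2) (h := fun w => nth 0 w 0 :: drop 2 w) tP.
move=> H; apply: eq_tc (H _ _) => [v sv /=|v sv /=|[|i] _ /=].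
- by rewrite drop0.
- by rewrite size_drop sv subn2.
- exact: tc_nth.
- by apply: tc_nth_drop; exists 2.
Qed.

Lemma tc_pred n a : tc n a -> tc n (fun v => (a v).-1).
Proof.
move=> ta; apply: eq_tc (tc_rec (B := fun=> 0) (st := fun k _ _ => k) ta _ _).
- by move=> v _; case: (a v).
- exact: tc_const.
- exact: tc_nth.
Qed.

Lemma tc_add n a b : tc n a -> tc n b -> tc n (fun v => a v + b v).
Proof.
move=> ta tb; apply: eq_tc (tc_rec (st := fun _ r _ => r.+1) tb ta _).
  by move=> v _; elim: (b v) => [|k IH] /=; rewrite ?addn0 // IH addnS.
exact/tc_succ/tc_nth.
Qed.

Lemma tc_double n a : tc n a -> tc n (fun v => (a v).*2).
Proof. by move=> ta; apply: eq_tc (tc_add ta ta) => v _; apply: addnn. Qed.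

Lemma tc_sub n a b : tc n a -> tc n b -> tc n (fun v => a v - b v).
Proof.
move=> ta tb; apply: eq_tc (tc_rec (st := fun _ r _ => r.-1) tb ta _).
  by move=> v _; elim: (b v) => [|k IH] /=; rewrite ?subn0 // IH subnS.
exact/tc_pred/tc_nth.
Qed.

Lemma tc_mul n a b : tc n a -> tc n b -> tc n (fun v => a v * b v).
Proof.
apply: tc_app2; apply: eq_tc (tc_rec (B := fun=> 0)
  (st := fun _ r v => r + nth 0 v 0) (tc_nth 2 1) _ _).
- move=> v _; elim: (nth 0 v 1) => [|k IH] /=; first by rewrite muln0.
  by rewrite IH mulnS addnC.
- exact: tc_const.
- by apply: tc_add (tc_nth _ _) (tc_nth_drop _ _ _); exists 2.
Qed.

Lemma tc_exp n a b : tc n a -> tc n b -> tc n (fun v => a v ^ b v).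
Proof.
apply: tc_app2; apply: eq_tc (tc_rec (B := fun=> 1)
  (st := fun _ r v => r * nth 0 v 0) (tc_nth 2 1) _ _).
- move=> v _; elim: (nth 0 v 1) => [|k IH] //=.
  by rewrite IH expnS mulnC.
- exact: tc_const.
- by apply: tc_mul (tc_nth _ _) (tc_nth_drop _ _ _); exists 2.
Qed.

Lemma tc_neg n b : tc n (fun v => nat_of_bool (b v)) -> tc n (fun v => nat_of_bool (~~ b v)).
Proof.
move=> tb; apply: eq_tc (tc_sub (tc_const n 1) tb).
by move=> v _; case: (b v).
Qed.

Lemma tc_leq n a b : tc n a -> tc n b -> tc n (fun v => nat_of_bool (a v <= b v)).
Proof.
move=> ta tb; apply: eq_tc (tc_sub (tc_const n 1) (tc_sub ta tb)).
by move=> v _; rewrite /leq; case: (a v - b v).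
Qed.

Lemma tc_and n a b : tc n (fun v => nat_of_bool (a v)) -> tc n (fun v => nat_of_bool (b v)) ->
  tc n (fun v => nat_of_bool (a v && b v)).
Proof.
move=> ta tb; apply: eq_tc (tc_mul ta tb).
by move=> v _; case: (a v); case: (b v).
Qed.

Lemma tc_or n a b : tc n (fun v => nat_of_bool (a v)) -> tc n (fun v => nat_of_bool (b v)) ->
  tc n (fun v => nat_of_bool (a v || b v)).
Proof.
move=> ta tb; apply: eq_tc (tc_neg (tc_and (tc_neg ta) (tc_neg tb))).
by move=> v _; rewrite negb_and !negbK.
Qed.

Lemma tc_eq n a b : tc n a -> tc n b -> tc n (fun v => nat_of_bool (a v == b v)).
Proof.
move=> ta tb; apply: eq_tc (tc_and (tc_leq ta tb) (tc_leq tb ta)).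
by move=> v _; rewrite eqn_leq.
Qed.

Lemma tc_if n c a b : tc n (fun v => nat_of_bool (c v)) -> tc n a -> tc n b ->
  tc n (fun v => if c v then a v else b v).
Proof.
move=> tC ta tb.
apply: eq_tc (tc_add (tc_mul tC ta) (tc_mul (tc_neg tC) tb)).
by move=> v _; case: (c v); rewrite ?mul0n ?mul1n ?addn0 ?add0n.
Qed.

Lemma tc_find n P N : tc n N -> tc n.+1 (fun w => nat_of_bool (P (nth 0 w 0) (drop 1 w))) ->
  tc n (fun v => find (fun k => P k v) (iota 0 (N v))).
Proof.
(* The accumulator is the result of the search below [k]; it equals [k] exactly when nothing has
   been found yet. *)
move=> tN tP; apply: eq_tc (tc_rec (B := fun=> 0)
  (st := fun k r v => if r < k then r else if P k v then k else k.+1) tN _ _).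
- move=> v _; elim: (N v) => [|m IH] //.
  rewrite -{2}(addn1 m) iotaD find_cat size_iota add0n has_find size_iota /= IH.
  by case: ifP => // _; case: (P m v); rewrite ?addn0 ?addn1.
- exact: tc_const.
- apply: tc_if; first by apply: tc_leq; [apply/tc_succ/tc_nth | apply: tc_nth].
    exact: tc_nth.
  apply: tc_if; [|exact: tc_nth|exact/tc_succ/tc_nth].
  exact: (tc_lift (P := fun k v => nat_of_bool (P k v))).
Qed.

Lemma tc_has n P N : tc n N -> tc n.+1 (fun w => nat_of_bool (P (nth 0 w 0) (drop 1 w))) ->
  tc n (fun v => nat_of_bool (has (fun k => P k v) (iota 0 (N v)))).
Proof.
move=> tN tP; apply: eq_tc (tc_leq (tc_succ (tc_find tN tP)) tN).
by move=> v _; rewrite has_find size_iota.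
Qed.

Lemma tc_all n P N : tc n N -> tc n.+1 (fun w => nat_of_bool (P (nth 0 w 0) (drop 1 w))) ->
  tc n (fun v => nat_of_bool (all (fun k => P k v) (iota 0 (N v)))).
Proof.
move=> tN tP; apply: eq_tc (tc_neg (tc_has tN (P := fun k v => ~~ P k v) (tc_neg tP))).
by move=> v _; rewrite -all_predC; congr nat_of_bool; apply: eq_all => k /=; rewrite negbK.
Qed.

(** * Pairs and lists as numbers *)

(* Linear in [l] for fixed [a], hence harmless for length bounds. *)
Definition pr a l := 2 ^ a * (l.*2.+1).

Lemma pr_gt a l : a < pr a l /\ l < pr a l.
Proof.
have := ltn_expl a (isT : 1 < 2); rewrite /pr; move: (2 ^ a) => k; split; nia.
Qed.

Lemma pr_inj a l a' l' : pr a l = pr a' l' -> a = a' /\ l = l'.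
Proof.
rewrite /pr; elim: a a' => [|a IH] [|a']; rewrite ?expnS ?expn0 ?mul1n -?mulnA ?mul2n.
- by move=> H; split=> //; lia.
- by lia.
- by lia.
- by move/double_inj/IH => [-> ->].
Qed.

(** Searching below [n] suffices, as both components lie below the code of a pair. At 0, the code of
    the empty list, [hd] and [tl] give 0, in accordance with the default of [nth 0]. *)
Definition hd n := find (fun a => has (fun l => pr a l == n) (iota 0 n)) (iota 0 n).
Definition tl n := find (fun l => has (fun a => pr a l == n) (iota 0 n)) (iota 0 n).

Lemma find_iota (P : nat -> bool) m n : m < n -> P m -> (forall k, P k -> k = m) ->
  find P (iota 0 n) = m.
Proof.
move=> mn Pm Pu; have hP : has P (iota 0 n).
  by apply/hasP; exists m; rewrite ?mem_iota.
have := nth_find 0 hP; rewrite nth_iota ?add0n; first by move/Pu.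
by move: hP; rewrite has_find size_iota.
Qed.

Lemma hd_pr a l : hd (pr a l) = a.
Proof.
have [al ll] := pr_gt a l; apply: find_iota => // [|k].
  by apply/hasP; exists l; rewrite ?mem_iota.
by case/hasP=> ? _ /eqP /pr_inj[].
Qed.

Lemma tl_pr a l : tl (pr a l) = l.
Proof.
have [al ll] := pr_gt a l; apply: find_iota => // [|k].
  by apply/hasP; exists a; rewrite ?mem_iota.
by case/hasP=> ? _ /eqP /pr_inj[].
Qed.

Definition lk L i := hd (iter i tl L).

Definition encl (s : seq nat) := foldr pr 0 s.

Lemma lk_encl s i : lk (encl s) i = nth 0 s i.
Proof.
rewrite /lk; elim: s i => [|a s IH] [|i] //=; rewrite ?hd_pr //.
  by have -> : iter i tl 0 = 0 by elim: i => //= i ->.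
by rewrite -iterS iterSr tl_pr IH.
Qed.

Lemma tc_pr n a b : tc n a -> tc n b -> tc n (fun v => pr (a v) (b v)).
Proof.
move=> ta tb; rewrite /pr; apply: tc_mul; first by apply: tc_exp => //; apply: tc_const.
exact/tc_succ/tc_double.
Qed.

Ltac tc_leaf := solve [apply: tc_const | apply: tc_nth |
  apply: tc_nth_drop; repeat apply: is_drop_drop; apply: is_drop_id].

Lemma tc_hd n a : tc n a -> tc n (fun v => hd (a v)).
Proof.
apply: tc_app1; rewrite /hd; apply: tc_find; first tc_leaf.
apply: tc_has; first tc_leaf.
by apply: tc_eq; [apply: tc_pr|]; tc_leaf.
Qed.

Lemma tc_tl n a : tc n a -> tc n (fun v => tl (a v)).
Proof.
apply: tc_app1; rewrite /tl; apply: tc_find; first tc_leaf.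
apply: tc_has; first tc_leaf.
by apply: tc_eq; [apply: tc_pr|]; tc_leaf.
Qed.

Lemma tc_lk n a b : tc n a -> tc n b -> tc n (fun v => lk (a v) (b v)).
Proof.
move=> ta tb; apply: tc_hd.
apply: eq_tc (tc_rec (st := fun _ r _ => tl r) tb ta _).
  by move=> v _; elim: (b v) => [|k IH] //=; rewrite IH.
by apply: tc_tl; tc_leaf.
Qed.

Ltac tc_step := lazymatch goal with
  | |- tc _ (fun _ => lk _ _) => apply: tc_lk
  | |- tc _ (fun _ => hd _) => apply: tc_hd
  | |- tc _ (fun _ => tl _) => apply: tc_tl
  | |- tc _ (fun _ => pr _ _) => apply: tc_pr
  | |- tc _ (fun _ => nat_of_bool (_ <= _)) => apply: tc_leq
  | |- tc _ (fun _ => nat_of_bool (_ == _)) => apply: tc_eq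
  | |- tc _ (fun _ => nat_of_bool (_ && _)) => apply: tc_and
  | |- tc _ (fun _ => nat_of_bool (~~ _)) => apply: tc_neg
  | |- tc _ (fun _ => nat_of_bool (all _ _)) => apply: tc_all
  | |- tc _ (fun _ => nat_of_bool (has _ _)) => apply: tc_has
  | |- tc _ (fun _ => find _ _) => apply: tc_find
  | |- tc _ (fun _ => if _ then _ else _) => apply: tc_if
  | |- tc _ (fun _ => _ + _) => apply: tc_add
  | |- tc _ (fun _ => _.*2) => apply: tc_double
  | |- tc _ (fun _ => S _) => apply: tc_succ
  end.

Ltac tc_tac := repeat first [tc_leaf | assumption | tc_step].

(** * Recursively enumerable relations *)

Definition re n (P : seq nat -> Prop) : Prop :=
  exists D : nat -> seq nat -> bool,
    tc n.+1 (fun w => nat_of_bool (D (nth 0 w 0) (drop 1 w))) /\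
    forall v, size v = n -> (P v <-> exists t, D t v).

Lemma eq_re n P Q : (forall v, size v = n -> (P v <-> Q v)) -> re n P -> re n Q.
Proof.
by move=> PQ [D [tD DP]]; exists D; split=> // v sv; rewrite -PQ // DP.
Qed.

Lemma re_tc n b : tc n (fun v => nat_of_bool (b v)) -> re n (fun v => b v).
Proof.
move=> tb; exists (fun _ v => b v); split=> [|v _]; last by split=> [|[]] //; exists 0.
apply: (tc_subst (f := fun v => nat_of_bool (b v)) (h := drop 1) tb) => [v|i _].
  by rewrite size_drop => ->; rewrite subn1.
by apply: tc_nth_drop; exists 1.
Qed.

Lemma re_eq n a b : tc n a -> tc n b -> re n (fun v => a v = b v).
Proof.
move=> ta tb; apply: eq_re (re_tc (tc_eq ta tb)) => v _.
by split=> [/eqP|->].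
Qed.

Lemma re_ltn n a b : tc n a -> tc n b -> re n (fun v => a v < b v).
Proof. by move=> ta tb; apply/re_tc/tc_leq => //; apply: tc_succ. Qed.

Lemma re_subst m n P h : re m P -> (forall v, size v = n -> size (h v) = m) ->
  (forall i, i < m -> tc n (fun v => nth 0 (h v) i)) -> re n (fun v => P (h v)).
Proof.
case=> D [tD DP] sh th; exists (fun t v => D t (h v)); split; last first.
  by move=> v sv; apply/DP/sh.
have := tc_subst (n := n.+1) (h := fun w => nth 0 w 0 :: h (drop 1 w)) tD.
move=> H; apply: eq_tc (H _ _) => [w _ /=|w sw /=|[|i] im /=]; rewrite ?drop0 //.
- by rewrite sh // size_drop sw subn1.
- exact: tc_nth.
- apply: (tc_subst (f := fun w => nth 0 (h w) i) (h := drop 1) (th i im)) => [w|j _].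
    by rewrite size_drop => ->; rewrite subn1.
  by apply: tc_nth_drop; exists 1.
Qed.

Lemma tc_subst_head n f g e : tc n.+1 (fun w => f (nth 0 w 0) (drop 1 w)) ->
  tc n.+1 g -> (forall w i, nth 0 (e w) i = nth 0 w i.+1) ->
  (forall w, size w = n.+1 -> size (e w) = n) ->
  tc n.+1 (fun w => f (g w) (e w)).
Proof.
move=> tf tg ne se.
have := tc_subst (n := n.+1) (h := fun w => g w :: e w) tf.
move=> H; apply: eq_tc (H _ _) => [w _ /=|w sw /=|[|i] im //=]; rewrite ?drop0 ?se //.
by apply: eq_tc (tc_nth _ i.+1) => w _; rewrite ne.
Qed.

Lemma re_and n P Q : re n P -> re n Q -> re n (fun v => P v /\ Q v).
Proof.
case=> D [tD DP] [E [tE EQ]].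
exists (fun t v => D (hd t) v && E (tl t) v); split.
  apply: tc_and.
    apply: (tc_subst_head (f := fun t v => nat_of_bool (D t v)) tD).
    - exact/tc_hd/tc_nth.
    - by move=> w i; rewrite nth_drop.
    - by move=> w sw; rewrite size_drop sw subn1.
  apply: (tc_subst_head (f := fun t v => nat_of_bool (E t v)) tE).
  - exact/tc_tl/tc_nth.
  - by move=> w i; rewrite nth_drop.
  - by move=> w sw; rewrite size_drop sw subn1.
move=> v sv; rewrite DP // EQ //; split=> [[[t Dt] [u Eu]]|[t /andP[Dt Et]]].
  by exists (pr t u); rewrite hd_pr tl_pr Dt.
by split; [exists (hd t)|exists (tl t)].
Qed.

Lemma re_or n P Q : re n P -> re n Q -> re n (fun v => P v \/ Q v).
Proof.
case=> D [tD DP] [E [tE EQ]].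
exists (fun t v => D t v || E t v); split; first exact: tc_or.
move=> v sv; rewrite DP // EQ //; split=> [[[t Dt]|[t Et]]|[t /orP[Dt|Et]]].
- by exists t; rewrite Dt.
- by exists t; rewrite Et orbT.
- by left; exists t.
- by right; exists t.
Qed.

Lemma re_ex n P : re n.+1 (fun w => P (nth 0 w 0) (drop 1 w)) ->
  re n (fun v => exists x, P x v).
Proof.
case=> D [tD DP].
exists (fun t v => D (tl t) (hd t :: v)); split.
  have := tc_subst (n := n.+1) (h := fun w => tl (nth 0 w 0) :: hd (nth 0 w 0) :: drop 1 w) tD.
  move=> H; apply: eq_tc (H _ _) => [w _ /=|w sw /=|[|[|i]] im //=]; rewrite ?drop0 //.
  - by rewrite size_drop sw subn1.
  - exact/tc_tl/tc_nth.
  - exact/tc_hd/tc_nth.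
  - by apply: tc_nth_drop; exists 1.
move=> v sv; split=> [[x Px]|[t Dt]].
  have /DP[|t Dt] : P (nth 0 (x :: v) 0) (drop 1 (x :: v)) by rewrite /= drop0.
    by rewrite /= sv.
  by exists (pr x t); rewrite hd_pr tl_pr.
exists (hd t).
have ex : exists u, D u (hd t :: v) by exists (tl t).
by have := proj2 (DP (hd t :: v) (congr1 S sv)) ex; rewrite /= drop0.
Qed.

(** One number codes a list with a witness for each [x < N v]; the finite choice is an induction on
    the bound. *)
Lemma re_all n P N : tc n N -> re n.+1 (fun w => P (nth 0 w 0) (drop 1 w)) ->
  re n (fun v => forall x, x < N v -> P x v).
Proof.
move=> tN [D [tD DP]].
exists (fun t v => all (fun x => D (lk t x) (x :: v)) (iota 0 (N v))); split.
  apply: (tc_all (P := fun x w => D (lk (nth 0 w 0) x) (x :: drop 1 w))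
     (N := fun w => N (drop 1 w))).
    apply: (tc_subst (h := drop 1) tN) => [w|i _].
      by rewrite size_drop => ->; rewrite subn1.
    by apply: tc_nth_drop; exists 1.
  have := tc_subst (n := n.+2) (h := fun w => lk (nth 0 (drop 1 w) 0) (nth 0 w 0)
    :: nth 0 w 0 :: drop 1 (drop 1 w)) tD.
  move=> H; apply: eq_tc (H _ _) => [w _ /=|w sw /=|[|[|i]] im //=]; rewrite ?drop0 //.
  - by rewrite !size_drop sw !subn1.
  - by apply: tc_lk (tc_nth _ _); apply: tc_nth_drop; exists 1.
  - exact: tc_nth.
  - by apply: tc_nth_drop; exists 2 => w; rewrite drop_drop.
move=> v sv; have DPx x : P x v <-> exists t, D t (x :: v).
  by have := DP (x :: v); rewrite /= drop0 sv; apply.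
split=> [H|[t /allP H] x xN]; last first.
  by apply/DPx; exists (lk t x); apply: H; rewrite mem_iota.
have [s ss sD] : exists2 s, size s = N v & forall x, x < N v -> D (nth 0 s x) (x :: v).
  elim: (N v) H => [|m IH] H; first by exists [::].
  have [x xm|s ss sD] := IH; first by apply/H/ltnW.
  have [t Dt] := proj1 (DPx m) (H m (ltnSn m)).
  exists (rcons s t) => [|x]; first by rewrite size_rcons ss.
  rewrite nth_rcons ss ltnS leq_eqVlt; case: eqP => [->|_] /=; first by rewrite ltnn.
  by move=> xm; rewrite xm; apply: sD.
exists (encl s); apply/allP=> x; rewrite mem_iota lk_encl; exact: sD.
Qed.

Ltac re_tac := repeat first [
   match goal with |- re _ (fun _ => exists _, _) => apply: re_ex end
 | match goal with |- re _ (fun _ => _ /\ _) => apply: re_and end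
 | match goal with |- re _ (fun _ => _ \/ _) => apply: re_or end
 | match goal with |- re _ (fun _ => forall _, _) => apply: re_all end
 | match goal with |- re _ (fun _ => _ = _) => apply: re_eq end
 | match goal with |- re _ (fun _ => is_true (_ < _)) => apply: re_ltn end
 | apply: re_tc ].

(** * A universal relation *)

(** Tags 6 and 7 build codes of lists of programs, so that judgements of [evalps] have the same
    shape as those of [evalp]. *)
Fixpoint enc (p : prf) : nat :=
  match p with
  | PZero => pr 0 0
  | PSucc => pr 1 0
  | PProj i => pr 2 i
  | PComp f gs => pr 3 (pr (enc f) (foldr (fun g c => pr 7 (pr (enc g) c)) (pr 6 0) gs))
  | PPrim f g => pr 4 (pr (enc f) (enc g))
  | PMin f => pr 5 (enc f)
  end.

Definition encs (gs : seq prf) := foldr (fun g c => pr 7 (pr (enc g) c)) (pr 6 0) gs.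

(* [jd c v y] codes the judgement "the program coded by [c] sends the vector coded by [v] to [y]",
   and [rule X j] says that [j] follows from judgements in [X] by one rule of [evalp]/[evalps]. *)
Definition jd c v y := pr c (pr v y).

Definition rule (X : nat -> Prop) (j : nat) : Prop :=
  (exists v, j = jd (pr 0 0) v 0) \/
  (exists v, j = jd (pr 1 0) v (lk v 0).+1) \/
  (exists i v, j = jd (pr 2 i) v (lk v i)) \/
  (exists f gs v ws y, j = jd (pr 3 (pr f gs)) v y /\ X (jd gs v ws) /\ X (jd f ws y)) \/
  (exists f g v y, j = jd (pr 4 (pr f g)) (pr 0 v) y /\ X (jd f v y)) \/
  (exists f g n v r y, j = jd (pr 4 (pr f g)) (pr n.+1 v) y /\
     X (jd (pr 4 (pr f g)) (pr n v) r) /\ X (jd g (pr n (pr r v)) y)) \/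
  (exists f v n, j = jd (pr 5 f) v n /\ X (jd f (pr n v) 0) /\
     forall k, k < n -> exists m, X (jd f (pr k v) m.+1)) \/
  (exists v, j = jd (pr 6 0) v 0) \/
  (exists g gs v y ys, j = jd (pr 7 (pr g gs)) v (pr y ys) /\ X (jd g v y) /\ X (jd gs v ys)).

(** [rule] speaks of plain numbers, so for a list of programs the result must also be recognised as
    the code of a vector. *)
Definition sound_jd j :=
  (forall p v y, j = jd (enc p) (encl v) y -> evalp p v y) /\
  (forall gs v w, j = jd (encs gs) (encl v) w -> exists2 ws, w = encl ws & evalps gs v ws).

Lemma encl_pr s a l : encl s = pr a l -> exists2 s', s = a :: s' & l = encl s'.
Proof.
case: s => [|b s] /=; first by have [] := pr_gt a l; case: pr.
by case/pr_inj=> -> <-; exists s.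
Qed.

Lemma jd_inj c v y c' v' y' : jd c v y = jd c' v' y' -> [/\ c = c', v = v' & y = y'].
Proof. by case/pr_inj=> -> /pr_inj[-> ->]. Qed.

Lemma rule_sound (X : nat -> Prop) j : (forall i, X i -> sound_jd i) -> rule X j -> sound_jd j.
Proof.
move=> sX; case=> [[v ->]|[[v ->]|[[i [v ->]]|[[f [gs [v [ws [y [-> [X1 X2]]]]]]]
  |[[f [g [v [y [-> X1]]]]]|[[f [g [n [v [r [y [-> [X1 X2]]]]]]]]
  |[[f [v [n [-> [X1 X2]]]]]|[[v ->]|[g [gs [v [y [ys [-> [X1 X2]]]]]]]]]]]]]]];
  split=> p u z /jd_inj[]; case: p;
  (* A rule and a constructor with different tags cannot meet; one case per rule remains. *)
  try by [move=> ep; case: (pr_inj ep) | move=> ? ep; case: (pr_inj ep)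
         |move=> ? ? ep; case: (pr_inj ep)].
- by move=> _ _ <-; apply: eZero.
- by move=> _ -> <-; rewrite lk_encl nth0; apply: eSucc.
- by move=> k /pr_inj[_ <-] -> <-; rewrite lk_encl; apply: eProj.
- move=> q qs /pr_inj[_ /pr_inj[ef egs]] ev <-.
  have [_ /(_ qs u ws)] := sX _ X1; rewrite egs ev => /(_ erefl)[us ews eus].
  by apply: eComp eus _; have [+ _] := sX _ X2; apply; rewrite ef ews.
- move=> q r /pr_inj[_ /pr_inj[ef eg]] /esym/encl_pr[u' -> ev] <-.
  by apply: ePrim0; have [+ _] := sX _ X1; apply; rewrite ef ev.
- move=> q q' /pr_inj[_ /pr_inj[ef eg]] /esym/encl_pr[u' -> ev] <-.
  apply: (ePrimS (r := r)).
    by have [+ _] := sX _ X1; apply; rewrite ef eg ev.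
  by have [+ _] := sX _ X2; apply; rewrite eg ev.
- move=> q /pr_inj[_ ef] ev <-; apply: eMin.
    by have [+ _] := sX _ X1; apply; rewrite ef ev.
  move=> k /X2[m Xm]; exists m.
  by have [+ _] := sX _ Xm; apply; rewrite ef ev.
- by move=> _ _ <-; exists [::] => //; apply: esNil.
- move=> q qs /pr_inj[_ /pr_inj[eg egs]] ev <-.
  have [_ /(_ qs u ys)] := sX _ X2; rewrite egs ev => /(_ erefl)[us -> eus].
  exists (y :: us) => //; apply: esCons eus.
  by have [+ _] := sX _ X1; apply; rewrite eg ev.
Qed.

(** A certificate checked entry by entry. As [rule] uses only existential and bounded universal
    quantifiers, the check is enumerable. *)
Definition valid (f : nat -> nat) m :=
  forall i, i < m -> rule (fun j => exists k, k < i /\ f k = j) (f i).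

Lemma valid_sound f m : valid f m -> forall i, i < m -> sound_jd (f i).
Proof.
move=> fm; elim/ltn_ind=> i IH im; apply: rule_sound (fm i im).
by move=> _ [k [ki <-]]; apply: IH ki (ltn_trans ki im).
Qed.

Lemma rule_mono (X Y : nat -> Prop) j : (forall i, X i -> Y i) -> rule X j -> rule Y j.
Proof.
move=> XY; case=> [H|[H|[H|[[f [gs [v [ws [y [-> [X1 X2]]]]]]]
  |[[f [g [v [y [-> X1]]]]]|[[f [g [n [v [r [y [-> [X1 X2]]]]]]]]
  |[[f [v [n [-> [X1 X2]]]]]|[H|[g [gs [v [y [ys [-> [X1 X2]]]]]]]]]]]]]]].
- by left.
- by right; left.
- by do 2 right; left.
- by do 3 right; left; exists f, gs, v, ws, y; do !split=> //; apply: XY.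
- by do 4 right; left; exists f, g, v, y; do !split=> //; apply: XY.
- by do 5 right; left; exists f, g, n, v, r, y; do !split=> //; apply: XY.
- do 6 right; left; exists f, v, n; split=> //; split=> [|k /X2[m Xm]]; first exact: XY.
  by exists m; apply: XY.
- by do 7 right; left.
- by do 8 right; exists g, gs, v, y, ys; do !split=> //; apply: XY.
Qed.

Definition derivation (s : seq nat) := valid (nth 0 s) (size s).

Lemma derivation_cat s t : derivation s -> derivation t -> derivation (s ++ t).
Proof.
move=> ds dt i; rewrite size_cat nth_cat; case: (ltnP i (size s)) => [lis _|lsi lit].
  apply: rule_mono (ds i lis) => j [k [ki kj]]; exists k; split=> //.
  by rewrite nth_cat (ltn_trans ki lis).
have lit' : i - size s < size t by lia.
apply: rule_mono (dt _ lit') => j [k [ki kj]]; exists (size s + k); split; first by lia.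
by rewrite nth_cat ltnNge leq_addr /= addKn.
Qed.

Lemma derivation_rcons s j : derivation s -> rule (fun i => i \in s) j -> derivation (rcons s j).
Proof.
move=> ds rj i; rewrite size_rcons ltnS leq_eqVlt nth_rcons.
case: (ltngtP i (size s)) => // [lis _|-> _].
  apply: rule_mono (ds i lis) => k [l [li lk]]; exists l; split=> //.
  by rewrite nth_rcons (ltn_trans li lis).
apply: rule_mono rj => k ks; exists (index k s); rewrite index_mem nth_rcons index_mem ks.
by split=> //; apply: nth_index.
Qed.

Definition derivable j := exists2 s, derivation s & j \in s.

(** Each rule has finitely many premises, so their derivations can be concatenated and the
    conclusion appended. *)
Lemma derivable_rule j : rule derivable j -> derivable j.
Proof.
suff H : rule derivable j -> exists2 s, derivation s & rule (fun i => i \in s) j.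
  case/H=> s ds rj; exists (rcons s j); last by rewrite mem_rcons mem_head.
  exact: derivation_rcons.
have d0 : derivation [::] by [].
case=> [H|[H|[H|[[f [gs [v [ws [y [-> [[s ds js] [t dt jt]]]]]]]]
  |[[f [g [v [y [-> [s ds js]]]]]]|[[f [g [n [v [r [y [-> [[s ds js] [t dt jt]]]]]]]]]
  |[[f [v [n [-> [[s ds js] X2]]]]]|[H|[g [gs [v [y [ys [-> [[s ds js] [t dt jt]]]]]]]]]]]]]]]].
- by exists [::] => //; left.
- by exists [::] => //; right; left.
- by exists [::] => //; do 2 right; left.
- exists (s ++ t); first exact: derivation_cat.
  by do 3 right; left; exists f, gs, v, ws, y; rewrite !mem_cat js jt orbT.
- by exists s => //; do 4 right; left; exists f, g, v, y.
- exists (s ++ t); first exact: derivation_cat.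
  by do 5 right; left; exists f, g, n, v, r, y; rewrite !mem_cat js jt orbT.
(* Minimisation has [n] further premises, whose derivations are joined by induction on [n]. *)
- have [t dt tP] : exists2 t, derivation t &
      forall k, k < n -> exists m, jd f (pr k v) m.+1 \in t.
    elim: n X2 {js} => [|n IH] X2; first by exists [::].
    have [k kn|t dt tP] := IH; first by apply/X2/ltnW.
    have [m [u du ju]] := X2 n (ltnSn n).
    exists (t ++ u); first exact: derivation_cat.
    move=> k; rewrite ltnS leq_eqVlt => /orP[/eqP->|/tP[l lt]].
      by exists m; rewrite mem_cat ju orbT.
    by exists l; rewrite mem_cat lt.
  exists (s ++ t); first exact: derivation_cat.
  do 6 right; left; exists f, v, n; split=> //; split=> [|k /tP[m mt]]; first by rewrite mem_cat js.
  by exists m; rewrite mem_cat mt orbT.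
- by exists [::] => //; do 7 right; left.
- exists (s ++ t); first exact: derivation_cat.
  by do 8 right; exists g, gs, v, y, ys; rewrite !mem_cat js jt orbT.
Qed.

Lemma derivable_eval p v y : evalp p v y -> derivable (jd (enc p) (encl v) y).
Proof.
move: p v y; apply: (evalp_mut_ind
  (P := fun p v y => derivable (jd (enc p) (encl v) y))
  (Q := fun gs v ws => derivable (jd (encs gs) (encl v) (encl ws)))).
- by move=> v; apply: derivable_rule; left; exists (encl v).
- by move=> v; apply: derivable_rule; right; left; exists (encl v); rewrite lk_encl nth0.
- by move=> i v; apply: derivable_rule; do 2 right; left; exists i, (encl v); rewrite lk_encl.
- move=> f gs v ws y Hg Hf; apply: derivable_rule; do 3 right; left.
  by exists (enc f), (encs gs), (encl v), (encl ws), y.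
- move=> f g v y Hf; apply: derivable_rule; do 4 right; left.
  by exists (enc f), (enc g), (encl v), y.
- move=> f g n v r y Hr Hg; apply: derivable_rule; do 5 right; left.
  by exists (enc f), (enc g), n, (encl v), r, y.
- move=> f v n H0 Hk; apply: derivable_rule; do 6 right; left.
  by exists (enc f), (encl v), n.
- by move=> v; apply: derivable_rule; do 7 right; left; exists (encl v).
- move=> g gs v y ys Hg Hs; apply: derivable_rule; do 8 right.
  by exists (enc g), (encs gs), (encl v), y, (encl ys).
Qed.

(** A Kleene-style universal relation: [L] codes a derivation, and [pr x 0] is [encl [:: x]]. *)
Definition univ c x y : Prop := exists L m, valid (lk L) m /\
  exists k, k < m /\ lk L k = jd c (pr x 0) y.

Lemma univP p x y : univ (enc p) x y <-> evalp p [:: x] y.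
Proof.
split=> [[L [m [Lm [k [km ek]]]]]|/derivable_eval[s ds js]].
  by have [+ _] := valid_sound Lm km; apply; rewrite ek.
exists (encl s), (size s); split.
  move=> i /ds; rewrite lk_encl; apply: rule_mono => j [k [ki <-]].
  by exists k; rewrite lk_encl.
by exists (index (jd (enc p) (encl [:: x]) y) s); rewrite index_mem lk_encl nth_index.
Qed.

Lemma re_univ n a b c : tc n a -> tc n b -> tc n c -> re n (fun v => univ (a v) (b v) (c v)).
Proof.
move=> ta tb tc'.
have r3 : re 3 (fun w => univ (nth 0 w 0) (nth 0 w 1) (nth 0 w 2)).
  rewrite /univ /valid /rule /jd; re_tac; tc_tac.
apply: (re_subst (h := fun v => [:: a v; b v; c v]) r3) => //.
by case=> [|[|[]]].
Qed.

Lemma re_halting (W : nat -> Prop) : re 1 (fun v => W (nth 0 v 0)) <->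
  exists p, forall x, W x <-> exists y, evalp p [:: x] y.
Proof.
split=> [[D [tD DW]]|[p pW]]; last first.
  have : re 1 (fun v => exists y, univ (enc p) (nth 0 v 0) y).
    by apply: re_ex; apply: re_univ; tc_tac.
  apply: eq_re => v _; rewrite pW; split=> -[y /univP]; by exists y.
(* [PMin] looks for a zero, hence the negation: it halts exactly when some [t] passes the test
   [D]. *)
have [q qP] := tc_neg tD.
have qt t x : evalp q [:: t; x] (~~ D t [:: x]) by apply: (qP [:: t; x]).
exists (PMin q) => x; rewrite (DW [:: x]) //; split=> [[t Dt]|[t et]]; last first.
  inversion et as [| | | | | |? ? ? e0 _]; subst; exists t.
  by apply/negPn/negP=> Dt; have := evalp_fun e0 (qt t x); rewrite Dt.
have ex : exists t, D t [:: x] by exists t.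
exists (ex_minn ex); case: ex_minnP => m Dm mm; apply: eMin.
  by have := qt m x; rewrite Dm.
move=> k km; exists 0; have := qt k x; case: (boolP (D k [:: x])) => // /mm.
by rewrite leqNgt km.
Qed.

(** * Completeness on numbers and self-reference *)

Definition tc1 (f : nat -> nat) := tc 1 (fun v => f (nth 0 v 0)).

(** Under [code], an additive constant in the length becomes a constant factor. *)
Definition linear (f : nat -> nat) := exists C, forall x, f x <= C * x.+1.

Definition complete (S : nat -> Prop) :=
  forall W, re 1 (fun v => W (nth 0 v 0)) ->
    exists f, [/\ tc1 f, linear f & forall x, W x <-> S (f x)].

(* The reduction of the slice [R c] is known, through its own index [c], to [R c] itself. *)
Lemma complete_recursion S (R : nat -> nat -> Prop) : complete S ->
  re 2 (fun v => R (nth 0 v 0) (nth 0 v 1)) ->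
  exists c f, [/\ tc1 f, linear f, forall z y, univ c (pr c z) y <-> y = f z
    & forall z, R c z <-> S (f z)].
Proof.
move=> cS rR.
(* All slices are reduced by one [h]; the slice to pick is the one at an index of [h] itself. *)
have [|h [th [C hC] hS]] := cS (fun n => R (hd n) (tl n)).
  apply: (re_subst (h := fun v => [:: hd (nth 0 v 0); tl (nth 0 v 0)]) rR) => //.
  by case=> [|[]] //= _; tc_tac.
have [p pP] := th.
exists (enc p), (fun z => h (pr (enc p) z)); split.
- by apply: (tc_app1 th); tc_tac.
- exists (C * (2 ^ enc p).*2); move=> z; apply: leq_trans (hC _) _.
  by rewrite /pr -mulnA leq_mul2l; apply/orP; right; have := expn_gt0 2 (enc p); move: (2 ^ _); nia.
- move=> z y; rewrite univP; have ph := pP [:: pr (enc p) z] erefl.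
  by split=> [e|->]; [apply: evalp_fun e ph | exact: ph].
- by move=> z; rewrite -hS hd_pr tl_pr.
Qed.

(** * Injective increasing reductions *)

(* [rank F z] counts the [k < z] that are kept when [k] is kept as soon as [F k] exceeds the
   number of points kept before it. *)
Definition rank (F : nat -> nat) z :=
  nat_rect (fun=> nat) 0 (fun k r => if r < F k then r.+1 else r) z.

Lemma rankS F z : rank F z.+1 = (rank F z < F z) + rank F z.
Proof. by rewrite /=; case: ifP. Qed.

Lemma eq_rank F G z : (forall k, k < z -> F k = G k) -> rank F z = rank G z.
Proof.
elim: z => // z IH FG; rewrite !rankS FG // IH // => k kz.
by apply: FG; apply: ltnW.
Qed.

Lemma leq_rank F : {homo rank F : k z / k <= z}.
Proof.
by apply: homo_leq => [//|k l m|z]; [exact: leq_trans | rewrite rankS leq_addl].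
Qed.

Lemma rank_skipped F z : z = rank F z + count (fun k => F k <= rank F k) (iota 0 z).
Proof.
elim: z => // z IH; rewrite rankS -[in iota _ _](addn1 z) iotaD count_cat add0n /= leqNgt.
by move: IH; case: (rank F z < F z) => /=; lia.
Qed.

(** A skipped [k < z] has [F k <= rank F k <= rank F z], so by injectivity at most [(rank F z).+1]
    points are skipped, while [rank F z] are kept. *)
Lemma rank_lower F z : injective F -> z <= (rank F z).*2.+1.
Proof.
move=> Fi; rewrite {1}(rank_skipped F z) -addnn -addnS leq_add2l.
rewrite -size_filter -(size_map F) -[leqRHS](size_iota 0); apply: uniq_leq_size.
  by rewrite map_inj_uniq // filter_uniq // iota_uniq.
move=> _ /mapP[k + ->]; rewrite mem_filter !mem_iota /= => /andP[Fk kz].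
by rewrite ltnS (leq_trans Fk) // leq_rank // ltnW.
Qed.

(** The rank grows by at most one at a time, and leaves the value [x] only at a kept point. *)
Lemma rank_cross F x m : x < rank F m -> exists z, [/\ z < m, rank F z = x & x < F z].
Proof.
elim: m => // m IH; rewrite rankS.
have [xr _|rx] := ltnP x (rank F m).
  by have [z [zm]] := IH xr; exists z; split=> //; apply: ltnW.
case: (ltnP (rank F m) (F m)) => [rF|_] /=; last by rewrite ltnNge rx.
rewrite ltnS => xr; have /eqP rm : rank F m == x by rewrite eqn_leq rx.
by exists m; rewrite -{2}rm.
Qed.

Lemma tc_rank n F N : tc n N -> tc n.+1 (fun w => F (nth 0 w 0) (drop 1 w)) ->
  tc n (fun v => rank (fun k => F k v) (N v)).
Proof.
move=> tN tF; apply: tc_rec => //; first tc_tac.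
by apply: tc_if; tc_tac; apply: (tc_lift (P := F) tF).
Qed.

Lemma rank_section F : tc1 F -> injective F ->
  exists e, [/\ tc1 e, forall x, e x <= x.*2.+1 & forall x, rank F (e x) = x /\ x < F (e x)].
Proof.
move=> tF Fi; pose Q x z := (rank F z == x) && (x < F z).
have hasQ x : has (Q x) (iota 0 x.*2.+2).
  (* At [x.*2.+2] the lower bound forces a rank above [x]. *)
  have [|z [zm rz xF]] := @rank_cross F x x.*2.+2.
    by have := @rank_lower F x.*2.+2 Fi; lia.
  by apply/hasP; exists z; rewrite ?mem_iota // /Q rz eqxx.
exists (fun x => find (Q x) (iota 0 x.*2.+2)); split=> [|x|x].
- rewrite /tc1 /Q; apply: tc_find; first tc_tac.
  have tF1 n a : tc n a -> tc n (fun v => F (a v)) by apply: tc_app1.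
  apply: tc_and; first by apply: tc_eq; first (apply: tc_rank; [|apply: tF1]); tc_tac.
  by apply: tc_leq; [|apply: tF1]; tc_tac.
- by have := hasQ x; rewrite has_find size_iota.
- have := nth_find 0 (hasQ x); rewrite nth_iota; last first.
    by have := hasQ x; rewrite has_find size_iota.
  by rewrite add0n => /andP[/eqP].
Qed.

(** * Forcing injectivity *)

Definition injb (F : nat -> nat) m :=
  all (fun u => all (fun y => F y != F u) (iota 0 u)) (iota 0 m).

Lemma injbP F m : reflect (forall y u, y < u -> u < m -> F y <> F u) (injb F m).
Proof.
apply: (iffP allP) => [H y u yu um|H u].
  have ui : u \in iota 0 m by rewrite mem_iota.
  have /allP/(_ y) := H u ui; rewrite mem_iota /= yu => /(_ isT)/eqP //.
by rewrite mem_iota => um; apply/allP=> y; rewrite mem_iota => yu; apply/eqP/H.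
Qed.

Lemma eq_injb F G m : (forall k, k < m -> F k = G k) -> injb F m = injb G m.
Proof.
move=> FG; apply: eq_in_all => u; rewrite mem_iota => /= um.
apply: eq_in_all => y; rewrite mem_iota => /= yu.
by rewrite !FG // (ltn_trans yu um).
Qed.

(** [z] serves as the copy of [rank F z], and the witness [s] shows that this number is in the
    enumerable set. *)
Definition kept (As : nat -> nat -> bool) F s z := (rank F z < F z) && As s (rank F z).

Lemma eq_kept As F G s z : (forall k, k <= z -> F k = G k) -> kept As F s z = kept As G s z.
Proof. by move=> FG; rewrite /kept FG // (@eq_rank F G) // => k /ltnW/FG. Qed.

(** The guard freezes the set at the first collision: if it occurs at [w], only the [s] with
    [z + s < w] count, so [spoil] can decide at [w] what was kept. *)
Definition keep As F s z := injb F (z + s).+1 && kept As F s z.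

Definition spoil As F z := injb F z &&
  has (fun y => (F y == F z) && ~~ has (fun s => (y + s < z) && kept As F s y) (iota 0 z))
      (iota 0 z).

(** Finite use: a finite table of values can stand for the function. *)
Lemma eq_keep As F G s z : (forall k, k < (z + s).+1 -> F k = G k) ->
  keep As F s z = keep As G s z.
Proof.
move=> FG; rewrite /keep (eq_injb FG) (@eq_kept As F G) // => k kz.
by apply: FG; rewrite ltnS (leq_trans kz) ?leq_addr.
Qed.

Lemma eq_spoil As F G z : (forall k, k < z.+1 -> F k = G k) -> spoil As F z = spoil As G z.
Proof.
move=> FG; rewrite /spoil (@eq_injb F G) => [|k /ltnW]; last exact: FG.
congr andb; apply: eq_in_has => y; rewrite mem_iota => /= yz.
rewrite !FG //; last exact: ltnW.
congr (_ && ~~ _); apply: eq_in_has => s _; rewrite (@eq_kept As F G) // => k ky.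
by apply: FG; rewrite ltnS (leq_trans ky) // ltnW.
Qed.

(* A first collision [F y = F z] would make [y] and [z] equivalent for [R], while [spoil]
   puts [z] into [R] exactly when [keep] leaves [y] out. *)
Lemma no_collision As F (R T : nat -> Prop) :
  (forall z, R z <-> (exists s, keep As F s z) \/ spoil As F z) ->
  (forall z, R z <-> T (F z)) -> injective F.
Proof.
move=> RE RT.
suff H m : injb F m.
  move=> y z Fyz; case: (ltngtP y z) => // [yz|zy].
    by have /injbP/(_ y z yz (ltnSn z) Fyz) := H z.+1.
  by have /injbP/(_ z y zy (ltnSn y) (esym Fyz)) := H y.+1.
elim: m => // z IH; apply/injbP=> y u yu.
rewrite ltnS leq_eqVlt => /orP[/eqP uz|]; last by move/injbP: IH; apply.
rewrite {u}uz in yu *; move=> Fyz.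
(* The collision of [y] and [z] makes [injb] fail beyond [z], so [keep] acts only before it. *)
have injS m : injb F m -> m <= z.
  by move/injbP=> Fm; rewrite leqNgt; apply/negP=> zm; apply: (Fm y z).
(* [y] collides with no earlier point, so it cannot have entered [R] through [spoil]. *)
have Ry : R y <-> exists2 s, y + s < z & kept As F s y.
  rewrite RE; split=> [[[s /andP[/injS ys ks]]|/andP[_ /hasP[x]]]|[s ys ks]].
  - by exists s.
  - rewrite mem_iota => /= xy /andP[/eqP Fxy _].
    by move/injbP: IH => /(_ x y xy yu Fxy).
  - left; exists s; rewrite /keep ks andbT; apply/injbP=> a b ab bm.
    by move/injbP: IH; apply=> //; apply: leq_trans bm _.
(* [z] comes too late to be kept, and since [F] is injective below [z], the only partner [spoil] can
   find is [y]. *)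
have Rz : R z <-> ~ R y.
  rewrite RE; split=> [[[s /andP[/injS]]|/andP[_ /hasP[x]]]|nRy].
  - by rewrite ltnNge leq_addr.
  - rewrite mem_iota => /= xz /andP[/eqP Fxz /hasPn nx].
    have xy : x = y.
      have [Fxy Fyx] : F x = F y /\ F y = F x by rewrite Fxz Fyz.
      case: (ltngtP x y) => // xy; move/injbP: IH.
        by move/(_ x y xy yu Fxy).
      by move/(_ y x xy xz Fyx).
    case/Ry=> s ys ks; have sz : s \in iota 0 z.
      by rewrite mem_iota /=; apply: leq_ltn_trans ys; apply: leq_addl.
    by have := nx s sz; rewrite xy ys ks.
  - right; rewrite /spoil IH; apply/hasP; exists y; first by rewrite mem_iota.
    rewrite Fyz eqxx; apply/hasPn=> s _; apply/negP=> /andP[ys ks].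
    by apply/nRy/Ry; exists s.
by have := RT y; have := RT z; rewrite Fyz; tauto.
Qed.

Lemma increasing_reduction S A : complete S -> re 1 (fun v => A (nth 0 v 0)) ->
  exists g, [/\ tc1 g, linear g, injective g, forall x, x < g x & forall x, A x <-> S (g x)].
Proof.
move=> cS [D [tD DA]].
have [As tAs AE] : exists2 As : nat -> nat -> bool,
    forall n a b, tc n a -> tc n b -> tc n (fun v => nat_of_bool (As (a v) (b v))) &
    forall x, A x <-> exists s, As s x.
  exists (fun s x => D s [:: x]) => [n a b|x]; last exact: (DA [:: x]).
  apply: (tc_app2 (F := fun s x => nat_of_bool (D s [:: x]))).
  by apply: eq_tc tD; case=> [|s [|x []]].
(* [L] tabulates values of program [c] on its own slice. Using tables keeps [R] enumerable even at
   those [c] that compute no total function. *)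
pose approx c (L m : nat) := forall u, u < m -> univ c (pr c u) (lk L u).
pose R c z := (exists s L : nat, approx c L (z + s).+1 /\ keep As (lk L) s z) \/
  (exists L : nat, approx c L z.+1 /\ spoil As (lk L) z).
have [|c [f [tf [C fC] fu fS]]] := complete_recursion (R := R) cS.
  have tR n a b : tc n a -> tc n b -> tc n (fun v => rank (lk (a v)) (b v)).
    by move=> ta tb; apply: (tc_app2 (F := fun L => rank (lk L)) _ ta tb);
    apply: (tc_rank (F := fun k v => lk (nth 0 v 0) k)); tc_tac.
  rewrite /R /approx /keep /spoil /injb /kept.
  re_tac; try apply: re_univ.
  all: repeat first [progress tc_tac | progress re_tac | apply: tR | apply: tAs].
have fL L m : approx c L m -> forall u, u < m -> lk L u = f u.
  by move=> H u /H /fu.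
have Lf m : approx c (encl (mkseq f m)) m.
  by move=> u um; apply/fu; rewrite lk_encl nth_mkseq.
have fR z : R c z <-> (exists s, keep As f s z) \/ spoil As f z.
  split=> [[[s [L [/fL E k]]]|[L [/fL E k]]]|[[s k]|k]].
  - by left; exists s; rewrite -(eq_keep _ E).
  - by right; rewrite -(eq_spoil _ E).
  - left; exists s, (encl (mkseq f (z + s).+1)); split; first exact: Lf.
    by rewrite (eq_keep _ (fL _ _ (Lf _))).
  - right; exists (encl (mkseq f z.+1)); split; first exact: Lf.
    by rewrite (eq_spoil _ (fL _ _ (Lf _))).
have fi := no_collision fR fS.
have [e [te eC eP]] := rank_section tf fi.
(* [e x] is the copy of [x], and [rank f] is a left inverse of [e], whence injectivity. *)
exists (fun x => f (e x)); split.
- exact: tc_app1 tf te.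
- exists C.*2 => x; apply: leq_trans (fC _) _.
  by rewrite -doubleMl doubleMr leq_mul2l doubleS ltnS eC orbT.
- by move=> x y /fi exy; rewrite -(proj1 (eP x)) exy (proj1 (eP y)).
- by move=> x; have [] := eP x.
move=> x; have [rx xf] := eP x; rewrite -fS fR AE.
(* As [f] is injective, the guard in [keep] always holds and [spoil] never does. *)
split=> [[s Ax]|[[s /andP[_ /andP[_]]]|/andP[_ /hasP[y]]]].
- left; exists s; rewrite /keep /kept rx xf Ax !andbT.
  by apply/injbP=> a b ab _ /fi ea; rewrite ea ltnn in ab.
- by rewrite rx; exists s.
- by rewrite mem_iota => /= yx /andP[/eqP/fi ey]; rewrite ey ltnn in yx.
Qed.

(** * A computable Cantor-Bernstein theorem *)

(** [x./2] is the least [k] with [x <= k.*2.+1]; at [x = 0] the empty search returns 0. *)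
Lemma tc_half n a : tc n a -> tc n (fun v => (a v)./2).
Proof.
apply: tc_app1.
have tf : tc 1 (fun v => find (fun k => nth 0 v 0 <= k.*2.+1) (iota 0 (nth 0 v 0))).
  apply: tc_find; tc_tac.
apply: eq_tc tf => v _; set x := nth 0 v 0.
have [->//|x0] := posnP x.
have hQ : has (fun k => x <= k.*2.+1) (iota 0 x).
  by apply/hasP; exists x.-1; rewrite ?mem_iota; lia.
have := hQ; rewrite has_find size_iota => fx.
have := nth_find 0 hQ; rewrite nth_iota // add0n => lf.
have := @before_find _ 0 (fun k => x <= k.*2.+1) (iota 0 x) x./2.
move: fx lf; set f := find _ _ => fx lf.
case: (ltnP x./2 f) => [hf /(_ isT)|hf _]; last by lia.
by rewrite nth_iota; lia.
Qed.

Lemma tc_odd n a : tc n a -> tc n (fun v => nat_of_bool (odd (a v))).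
Proof.
move=> ta; apply: eq_tc (tc_neg (tc_eq (tc_double (tc_half ta)) ta)) => v _.
congr nat_of_bool; have := odd_double_half (a v); lia.
Qed.

(** A failed search returns [s], so the root of a chain is its own parent. *)
Definition parent (G : nat -> nat) s := find (fun u => G u == s) (iota 0 s).

(** Proper steps to a parent decrease, so [s] of them reach the root, where further steps do
    nothing. *)
Definition origin G s := iter s (parent G) s.

(* Swaps the two ends of the edges [s -- G s] for which [s] has the parity of its origin; every
   point lies on exactly one such edge. *)
Definition swap G s := if odd (origin G s) == odd s then G s else parent G s.

Lemma parentK G s : injective G -> (forall u, u < G u) ->
  parent G (G s) = s.
Proof.
by move=> Gi Gl; apply: find_iota => // k /eqP/Gi.
Qed.

Lemma parentP G s : parent G s = s \/ parent G s < s /\ G (parent G s) = s.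
Proof.
have := find_size (fun u => G u == s) (iota 0 s); rewrite size_iota leq_eqVlt -/(parent G s).
case/orP=> [/eqP|lt]; [by left|right; split=> //].
have : has (fun u => G u == s) (iota 0 s) by rewrite has_find size_iota.
by move/(nth_find 0); rewrite nth_iota // => /eqP.
Qed.

Lemma origin_iter G n s : s <= n -> iter n (parent G) s = origin G s.
Proof.
elim/ltn_ind: s n => s IH n sn.
case: (parentP G s) => [ps|[ps _]].
  have fx m : iter m (parent G) s = s by elim: m => //= m ->.
  by rewrite /origin !fx.
case: n sn => [|n] sn; first by have := leq_trans ps sn.
rewrite iterSr (IH _ ps); last by lia.
case: s {sn} IH ps => // s IH ps.
by rewrite {2}/origin iterSr (IH _ ps).
Qed.

Lemma origin_parent G s : origin G (parent G s) = origin G s.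
Proof.
case: (parentP G s) => [-> //|[ps _]].
by rewrite -(@origin_iter G s.+1 s) // iterSr (@origin_iter G s) // ltnW.
Qed.

(** A root is its own origin, so differing parities rule out a root. *)
Lemma swap_parent G s : odd (origin G s) != odd s -> G (parent G s) = s.
Proof.
case: (parentP G s) => [ps|[] //]; rewrite /origin.
have -> : iter s (parent G) s = s by elim: {1}s => //= m ->.
by rewrite eqxx.
Qed.

(** Along [G] the origin is preserved and the parity flips, so the two ends of a swapped edge take
    opposite branches of [swap]. *)
Lemma swapK G : injective G -> (forall s, s < G s) ->
  (forall s, odd (G s) = ~~ odd s) -> involutive (swap G).
Proof.
move=> Gi Gl Godd s; rewrite {2}/swap; case: ifP => [/eqP os|/negbT ns]; rewrite /swap.
  by rewrite -origin_parent parentK // os Godd; case: (odd s) => /=.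
have gs := swap_parent ns.
rewrite origin_parent gs; have := Godd (parent G s); rewrite gs.
by move: ns; case: (odd s); case: (odd (origin _ _)); case: (odd (parent _ _)).
Qed.

Lemma odd_swap G : (forall s, odd (G s) = ~~ odd s) ->
  forall s, odd (swap G s) = ~~ odd s.
Proof.
move=> Godd s; rewrite /swap; case: ifP => [_|/negbT/swap_parent gs]; first exact: Godd.
by rewrite -{2}gs Godd negbK.
Qed.

Lemma swap_iff G (Q : nat -> Prop) : (forall s, Q s <-> Q (G s)) ->
  forall s, Q s <-> Q (swap G s).
Proof.
move=> QG s; rewrite /swap; case: ifP => [_|/negbT/swap_parent gs]; first exact: QG.
by rewrite (QG (parent G s)) gs.
Qed.

Lemma swap_leq G : (forall s, s < G s) -> forall s, swap G s <= G s.
Proof.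
move=> Glt s; rewrite /swap; case: ifP => // _.
by apply: leq_trans (ltnW (Glt s)); case: (parentP G s) => [->|[/ltnW]].
Qed.

Lemma tc_swap G : tc1 G -> tc1 (swap G).
Proof.
move=> tG; have tGa n a : tc n a -> tc n (fun v => G (a v)) by apply: tc_app1.
have tP n a : tc n a -> tc n (fun v => parent G (a v)).
  apply: tc_app1; rewrite /parent; apply: tc_find; first tc_tac.
  by apply: tc_eq; [apply: tGa|]; tc_tac.
rewrite /tc1 /swap; apply: tc_if; [|by apply: tGa; tc_tac|by apply: tP; tc_tac].
have to : tc 1 (fun v => origin G (nth 0 v 0)).
  apply: eq_tc (tc_rec (st := fun _ r _ => parent G r) (tc_nth 1 0) (tc_nth 1 0) _).
    move=> v _; rewrite /origin; set x := nth 0 v 0.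
    suff H m : nat_rect (fun=> nat) x (fun _ r => parent G r) m = iter m (parent G) x by [].
    by elim: m => //= m ->.
  by apply: tP; tc_tac.
have te : tc 1 (fun v => nat_of_bool (odd (origin G (nth 0 v 0)) == odd (nth 0 v 0) :> nat)).
  by apply: tc_eq; apply: tc_odd; tc_tac.
by apply: eq_tc te => v _; congr nat_of_bool; case: odd; case: odd.
Qed.

Lemma computable_bernstein (S S' : nat -> Prop) g g' :
  tc1 g -> tc1 g' -> linear g -> linear g' -> injective g -> injective g' ->
  (forall x, x < g x) -> (forall x, x < g' x) ->
  (forall x, S x <-> S' (g x)) -> (forall x, S' x <-> S (g' x)) ->
  exists h k, [/\ tc1 h, cancel h k /\ cancel k h, linear h, linear k
    & forall x, S x <-> S' (h x)].
Proof.
move=> tg tg' [C gC] [C' gC'] gi gi' gx gx' gS gS'.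
(* Both sides live in one set of numbers: [x.*2] is [x] on the side of [S], [y.*2.+1] is [y] on the
   side of [S']. The involution [swap G] exchanges the sides and so yields the bijection. *)
pose G s := if odd s then (g' s./2).*2 else (g s./2).*2.+1.
have Ginj : injective G.
  move=> s t; rewrite /G; move: (odd_double_half s) (odd_double_half t).
  case: (odd s); case: (odd t) => /= es et E; try lia.
  - have /gi' : g' s./2 = g' t./2 by lia.
    by lia.
  - have /gi : g s./2 = g t./2 by lia.
    by lia.
have Glt s : s < G s.
  rewrite /G; have := gx s./2; have := gx' s./2; have := odd_double_half s.
  by case: (odd s) => /=; lia.
have Godd s : odd (G s) = ~~ odd s by rewrite /G; case: ifP => _ /=; rewrite odd_double.
have tG : tc1 G.
  have tga n a : tc n a -> tc n (fun v => g (a v)) by apply: tc_app1.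
  have tga' n a : tc n a -> tc n (fun v => g' (a v)) by apply: tc_app1.
  rewrite /tc1 /G; apply: tc_if; first by apply: tc_odd; tc_tac.
    by apply: tc_double; apply: tga'; apply: tc_half; tc_tac.
  by apply: tc_succ; apply: tc_double; apply: tga; apply: tc_half; tc_tac.
have tJ n a : tc n a -> tc n (fun v => swap G (a v)) by apply/tc_app1/tc_swap.
have GC s : G s <= ((C + C') * s.+1).*2.+1.
  rewrite /G; case: ifP => _.
    by have := gC' s./2; have := leq_half_double s s; nia.
  by have := gC s./2; nia.
have J2 x : swap G x.*2 = (swap G x.*2)./2.*2.+1.
  by rewrite -{1}(odd_double_half (swap G _)) odd_swap // odd_double.
have J1 x : swap G x.*2.+1 = (swap G x.*2.+1)./2.*2.
  by rewrite -{1}(odd_double_half (swap G _)) odd_swap //= odd_double.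
exists (fun x => (swap G x.*2)./2), (fun y => (swap G y.*2.+1)./2); split.
- by apply: tc_half; apply: tJ; apply: tc_double; tc_tac.
- split=> x.
    by rewrite -J2 swapK // doubleK.
  by rewrite -J1 swapK //= uphalf_double.
- exists (C + C').*2.+1 => x; have := swap_leq Glt x.*2; have := GC x.*2; nia.
- exists (C + C').*2.+1 => x; have := swap_leq Glt x.*2.+1; have := GC x.*2.+1; nia.
move=> x; pose Q s := if odd s then S' s./2 else S s./2.
have QG s : Q s <-> Q (G s).
  rewrite /Q Godd /G; case: (odd s) => /=; first by rewrite doubleK.
  by rewrite uphalf_double.
by have := swap_iff QG x.*2; rewrite /Q odd_swap // odd_double doubleK.
Qed.

(** * Strings *)

Lemma code_inj : injective code.
Proof.
elim=> [|b s IH] [|c t] //=; try (by rewrite addn1); move=> E.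
have bc : b = c by case: b E; case: c; lia.
by rewrite bc (IH t) //; move: E; rewrite bc; lia.
Qed.

(** The boolean equality lets [xchoose] extract the string. *)
Lemma code_surj n : exists s, code s == n.
Proof.
elim/ltn_ind: n => -[|n] IH; first by exists [::].
have [|s /eqP es] := IH n./2; first by have := odd_double_half n; lia.
exists (odd n :: s); apply/eqP; rewrite /= es; have := odd_double_half n; lia.
Qed.

Definition decode n := xchoose (code_surj n).

Lemma decodeK n : code (decode n) = n.
Proof. exact/eqP/(xchooseP (code_surj n)). Qed.

Lemma codeK s : decode (code s) = s.
Proof. by apply: code_inj; rewrite decodeK. Qed.

(** In binary, [(code s).+1] is a leading 1 followed by [s] reversed. *)
Lemma size_code s : 2 ^ size s <= (code s).+1 < 2 ^ (size s).+1.
Proof.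
by elim: s => //= b s; rewrite !expnS; case: b; lia.
Qed.

Lemma length_bounded_linear h : length_bounded h <-> linear (fun n => code (h (decode n))).
Proof.
split=> [[c hc]|[C hC]].
  exists (2 ^ c.+1) => n; have := hc (decode n).
  have /andP[_] := size_code (h (decode n)); have /andP[+ _] := size_code (decode n).
  rewrite decodeK => sn hn sc.
  have: 2 ^ (size (h (decode n))).+1 <= 2 ^ c.+1 * 2 ^ size (decode n).
    by rewrite -expnD leq_exp2l // addSn ltnS addnC.
  move=> le; apply: leq_trans (leq_trans le (leq_mul (leqnn _) sn)).
  exact: ltnW (ltnW hn).
(* The factor [C.+2] is below [2 ^ C.+2], so it adds at most [C.+2] to the length. *)
exists C.+2 => x; have := hC (code x); rewrite codeK => hx.
have /andP[+ _] := size_code (h x); have /andP[_] := size_code x => xl lh.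
rewrite -ltnS -(@ltn_exp2l 2) //; apply: leq_ltn_trans lh _.
have Cx : (C.+2 * (code x).+1) < 2 ^ C.+2 * (code x).+1 by rewrite ltn_pmul2r // ltn_expl.
have : 2 ^ C.+2 * (code x).+1 < 2 ^ C.+2 * 2 ^ (size x).+1 by rewrite ltn_pmul2l // expn_gt0.
by rewrite -expnD; have -> : (size x + C.+2).+1 = C.+2 + (size x).+1; lia.
Qed.

Lemma computable_tc1 h : computable h <-> tc1 (fun n => code (h (decode n))).
Proof.
split=> -[p pP]; exists p.
  by case=> [|n []] // _; have := pP (decode n); rewrite decodeK.
by move=> x; have := pP [:: code x] erefl; rewrite /= codeK.
Qed.

Definition nat_set (S : seq bool -> Prop) n := S (decode n).

Lemma re_enumerable S : enumerable S <-> re 1 (fun v => nat_set S (nth 0 v 0)).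
Proof.
rewrite re_halting; split=> -[p pP]; exists p => x; rewrite /nat_set.
  by rewrite pP decodeK.
by rewrite -pP /nat_set codeK.
Qed.

Lemma m_optimal_complete S : m_optimal S -> complete (nat_set S).
Proof.
case=> _ oS W rW; have [|h [ch [lh hW]]] := oS (fun x => W (code x)).
  by apply/re_enumerable; apply: eq_re rW => v _; rewrite /nat_set decodeK.
exists (fun n => code (h (decode n))); split.
- exact/computable_tc1.
- exact/length_bounded_linear.
- by move=> n; rewrite /nat_set codeK -hW decodeK.
Qed.

Theorem theorem2p12 (S S' : seq bool -> Prop) :
  m_optimal S -> m_optimal S' ->
  exists h g : seq bool -> seq bool,
    [/\ computable h, cancel h g /\ cancel g h,
        length_bounded h, length_bounded g
      & forall x, S x <-> S' (h x)].
Proof.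
move=> oS oS'; have cS := m_optimal_complete oS; have cS' := m_optimal_complete oS'.
have [rS rS'] := (proj1 (re_enumerable S) (proj1 oS), proj1 (re_enumerable S') (proj1 oS')).
have [g [tg lg gi gx gS]] := increasing_reduction cS' rS.
have [g' [tg' lg' gi' gx' gS']] := increasing_reduction cS rS'.
have [h [k [th [hK kK] lh lk hS]]] :=
  computable_bernstein tg tg' lg lg' gi gi' gx gx' gS gS'.
exists (fun x => decode (h (code x))), (fun y => decode (k (code y))); split.
- by apply/computable_tc1; apply: eq_tc th => v _; rewrite !decodeK.
- by split=> x; rewrite decodeK ?hK ?kK codeK.
- by apply/length_bounded_linear; case: lh => C hC; exists C => n; rewrite !decodeK.
- by apply/length_bounded_linear; case: lk => C kC; exists C => n; rewrite !decodeK.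
- by move=> x; have := hS (code x); rewrite /nat_set codeK.
Qed.
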